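(* Let $0<q\le 1$, $\mu>0$, $x_0\in\mathbb{R}$, let $\Delta\ge 1$ be an integer, and let $\gamma\in\mathbb{R}$ satisfy $\gamma+1>0$. Let $f(x)=\mu x(1-x)$ for $x\in\mathbb{R}$, and let the real sequence $(x(n))_{n\ge 0}$ be defined by $x(0)=x_0$ and, for every integer $n\ge 0$, $$ x(n+1)=\begin{cases} x_0+\dfrac{1}{\Gamma(q)}\displaystyle\sum_{j=1}^{n+1}\frac{\Gamma(n+1-j+q)}{\Gamma(n+1-j+1)}\,f(x(j-1)) &\text{if } n \bmod \Delta\ne0,\\[3mm] (1+\gamma)\left(x_0+\dfrac{1}{\Gamma(q)}\displaystyle\sum_{j=1}^{n+1}\frac{\Gamma(n+1-j+q)}{\Gamma(n+1-j+1)}\,f(x(j-1))\right) &\text{if } n \bmod \Delta=0. \end{cases} $$ Then for every integer $n\ge 0$, $$ x(n)\le\max\left\{x_0+\frac{((n+1)^q+1)\mu}{4q},\ (1+\gamma)\left(x_0+\frac{((n+1)^q+1)\mu}{4q}\right)\right\}. $$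
   Context: $\Gamma$ denotes the Euler Gamma function. The sequence $(x(n))$ is the impulsively controlled discrete logistic map of fractional order $q$: $\mu$ is the bifurcation parameter, $\gamma$ the impulse, and $\Delta$ the number of steps between impulses. *)

(* Defs.v *)
From HB Require Import structures.
From mathcomp Require Import all_boot all_order all_algebra.
From mathcomp Require Import all_classical all_reals all_analysis.
Set Implicit Arguments.
Unset Strict Implicit.
Unset Printing Implicit Defensive.
Import Order.TTheory GRing.Theory Num.Theory.
Import numFieldNormedType.Exports.
Local Open Scope classical_set_scope.
Local Open Scope ring_scope.

(* Euler's integral, convergent for 0 < z; for other z the extended-real
   integral is +oo and its real value defaults to 0. *)
Definition Gamma (R : realType) (z : R) : R :=
  \int[@lebesgue_measure R]_(t in `]0, +oo[) (t `^ (z - 1) * expR (- t)).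

Definition logistic (R : realType) (mu x : R) : R := mu * x * (1 - x).

(* Value at n + 1 of the discrete Caputo (Volterra) equation of order q with
   right-hand side f and initial value x 0 = x0, before any impulse. *)
Definition frac_step (R : realType) (q x0 : R) (f : R -> R) (x : nat -> R)
    (n : nat) : R :=
  x0 + (Gamma q)^-1 *
    \sum_(1 <= j < n.+2)
      Gamma (n.+1%:R - j%:R + q) / Gamma (n.+1%:R - j%:R + 1) * f (x j.-1).

(* Main.v *)
(* Since f <= mu/4 and the weights are nonnegative, it suffices to bound their
   sum. By the functional equation of Gamma the k-th weight is
   Gamma(k+q) / (Gamma(q) k!) = q(q+1)...(q+k-1) / k!, and q times the sum of
   these for k <= n telescopes to q(q+1)...(q+n) / n!. As
   (q+m) / (m+1) <= ((m+2)/(m+1))^(q-1), this is at most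
   (n+1) (n+2)^(q-1) <= (n+2)^q. *)
Require Import Defs.
From mathcomp Require Import all_boot all_order all_algebra.
From mathcomp Require Import all_classical all_reals all_analysis.
From mathcomp Require Import measurable_realfun ring lra.
Import Order.TTheory GRing.Theory Num.Theory.
Import numFieldNormedType.Exports.
Local Open Scope ring_scope.

(** * Rising factorials and the sum of the weights *)

Section rising_factorial.
Context {R : realType}.
Implicit Types (q : R) (n k : nat).

Definition rising q n : R := \prod_(i < n) (q + i%:R).

Lemma rising0 q : rising q 0 = 1.
Proof. by rewrite /rising big_ord0. Qed.

Lemma risingS q n : rising q n.+1 = rising q n * (q + n%:R).
Proof. by rewrite /rising big_ord_recr. Qed.

Lemma rising_ge0 q n : 0 <= q -> 0 <= rising q n.
Proof. by move=> q0; apply: prodr_ge0 => i _; rewrite addr_ge0. Qed.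

(** With [P := rising q n.+1], the inductive step is P/n! + q P/(n+1)! = P (q+n+1)/(n+1)!. *)
Lemma sum_rising_fact q n :
  q * (\sum_(k < n.+1) rising q k / k`!%:R) = rising q n.+1 / n`!%:R.
Proof.
elim: n => [|n IHn].
  by rewrite big_ord1 risingS rising0 fact0; field.
rewrite big_ord_recr mulrDr IHn /= (risingS q n.+1) factS natrM.
have : n`!%:R != 0 :> R by rewrite pnatr_eq0 -lt0n fact_gt0.
have : n.+1%:R != 0 :> R by rewrite pnatr_eq0.
by move: n`!%:R n.+1%:R => f N N0 f0; field; rewrite N0 f0.
Qed.

(* From 1 - u <= exp(-u) with u = (1-q)/a, and 1 + 1/a <= exp(1/a). *)
Lemma powR_succ_ge (a q : R) : 0 < a -> q <= 1 ->
  a `^ (q - 1) * ((q + (a - 1)) / a) <= (a + 1) `^ (q - 1).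
Proof.
move=> a0 q1.
have q1' : 0 <= 1 - q by lra.
have -> : q - 1 = - (1 - q) by ring.
set u := (1 - q) / a.
have -> : (q + (a - 1)) / a = 1 + - u by rewrite /u; field; rewrite gt_eqF.
apply: (@le_trans _ _ (a `^ (- (1 - q)) * expR (- u))).
  by rewrite ler_wpM2l ?powR_ge0 ?expR_ge1Dx.
rewrite !powRN expRN -invfM lef_pV2 ?posrE; last 2 first.
- by rewrite mulr_gt0 ?powR_gt0 ?expR_gt0.
- by rewrite powR_gt0; lra.
have -> : expR u = expR (a^-1) `^ (1 - q) by rewrite -expRM mulrC.
rewrite -powRM ?expR_ge0 ?(ltW a0)//.
apply: (ge0_ler_powR q1'); rewrite ?nnegrE.
- by lra.
- by rewrite mulr_ge0 ?expR_ge0 ?ltW.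
have := expR_ge1Dx a^-1; rewrite -(ler_pM2l a0) mulrDr divff ?gt_eqF//; lra.
Qed.

Lemma rising_fact_le q n : 0 < q -> q <= 1 ->
  rising q n / n`!%:R <= n.+1%:R `^ (q - 1).
Proof.
move=> q0 q1; elim: n => [|n IHn].
  by rewrite rising0 fact0 powR1 invr1 mulr1.
rewrite risingS factS natrM.
(* Splits off the factor treated by [powR_succ_ge] at a = n+1, where q + n reads q + (a - 1). *)
have -> : rising q n * (q + n%:R) / (n.+1%:R * n`!%:R) =
    rising q n / n`!%:R * ((q + (n.+1%:R - 1)) / n.+1%:R).
  have : n`!%:R != 0 :> R by rewrite pnatr_eq0 -lt0n fact_gt0.
  have : n.+1%:R != 0 :> R by rewrite pnatr_eq0.
  rewrite -natr1; move: n`!%:R n%:R => f N N0 f0.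
  by field; rewrite N0 f0.
rewrite -[n.+2%:R]natr1; apply: le_trans (powR_succ_ge _ _ _ q1) => //.
rewrite ler_wpM2r// divr_ge0//.
by rewrite -natr1 addrK addr_ge0// ltW.
Qed.

Lemma sum_rising_fact_le q n : 0 < q -> q <= 1 ->
  \sum_(k < n.+1) rising q k / k`!%:R <= n.+2%:R `^ q / q.
Proof.
move=> q0 q1; rewrite ler_pdivlMr// mulrC sum_rising_fact.
(* Completing n! to (n+1)! makes [rising_fact_le] applicable at n+1; the factor n+1 left over is at
   most n+2, which raises the power from q-1 to q. *)
have -> : rising q n.+1 / n`!%:R = n.+1%:R * (rising q n.+1 / n.+1`!%:R).
  have : n`!%:R != 0 :> R by rewrite pnatr_eq0 -lt0n fact_gt0.
  have : n.+1%:R != 0 :> R by rewrite pnatr_eq0.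
  rewrite factS natrM; move: n`!%:R n.+1%:R => f N N0 f0.
  by field; rewrite N0 f0.
rewrite -(mulr_powRB1 _ q0)//.
apply: ler_pM => //; last exact: rising_fact_le.
  by rewrite divr_ge0// rising_ge0// ltW.
by rewrite ler_nat.
Qed.

End rising_factorial.

(** * The functional equation of Gamma and its values at positive integers *)

Section gamma_function.
Context {R : realType}.
Implicit Types (z a b : R) (k : nat).
Local Notation mu := (@lebesgue_measure R).
Local Open Scope classical_set_scope.

(** A positive factor keeps an infinite value infinite, and [fine] sends both infinities to 0. *)
Lemma fine_mul_gt0 z (x : \bar R) : 0 < z -> fine (z%:E * x)%E = z * fine x.
Proof.
move=> z0; case: x => [r //| |].
  by rewrite mulry gtr0_sg// mul1e /= mulr0.
by rewrite mulrNy gtr0_sg// mul1e /= mulr0.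
Qed.

(** The integrand of Gamma(z+1). *)
Let h z (t : R) : R := t `^ z * expR (- t).

Let continuous_expRN : continuous (fun t : R => expR (- t)).
Proof.
by move=> t; apply: continuous_comp; [exact: continuousN|exact: continuous_expR].
Qed.

Let h_ge0 z t : 0 <= h z t.
Proof. by rewrite mulr_ge0 ?powR_ge0 ?expR_ge0. Qed.

Let measurable_h z (D : set R) : measurable D -> measurable_fun D (h z).
Proof.
move=> mD; apply: measurable_funTS; apply: measurable_funM.
  exact: measurable_powR.
by apply: continuous_measurable_fun; exact: continuous_expRN.
Qed.

Let continuous_powR_gt0 z t : 0 < t -> {for t, continuous (fun s : R => s `^ z)}.
Proof.
move=> t0; apply/differentiable_continuous/derivable1_diffP.
by apply: derivable_powR; rewrite in_itv/= t0.
Qed.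

Let is_derive_expRN (t : R) :
  is_derive t 1 (fun s : R => - expR (- s)) (expR (- t)).
Proof.
by apply: is_derive_eq; rewrite mulrN1 opprK.
Qed.

(** Integration by parts with antiderivative -exp(-t). The interval stays away from 0, where t^z
    fails to be differentiable for z < 1. *)
Let integral_h_parts z a b : 0 < z -> 0 < a -> a < b ->
  (\int[mu]_(t in `[a, b]) (h z t)%:E =
   (h z a - h z b)%:E + z%:E * \int[mu]_(t in `[a, b]) (h (z - 1) t)%:E)%E.
Proof.
move=> z0 a0 ab.
have pos x : x \in `[a, b]%R -> 0 < x.
  by rewrite in_itv/= => /andP[ax _]; exact: lt_le_trans a0 ax.
rewrite /h (@integration_by_parts R (fun s => s `^ z) (fun s => - expR (- s))
  (fun x => z * x `^ (z - 1)) (fun t => expR (- t)))//.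
- under eq_integral do rewrite mulrN EFinN.
  rewrite integral_ge0N/=; last first.
    by move=> x _; rewrite lee_fin !mulr_ge0 ?powR_ge0 ?expR_ge0// ltW.
  rewrite oppeK; congr (_ + _)%E; first by congr (_%:E); ring.
  under eq_integral do rewrite -mulrA EFinM.
  rewrite ge0_integralZl//=.
  + by apply/measurable_EFinP; exact: measurable_h.
  + by move=> x _; rewrite lee_fin h_ge0.
  + by rewrite lee_fin ltW.
- apply: continuous_in_subspaceT => x; rewrite inE => /pos x0.
  by rewrite /prop_for /continuous_at; apply: cvgM; [exact: cvg_cst|exact: continuous_powR_gt0].
- split.
  + move=> x xab; apply: derivable_powR; rewrite in_itv/= andbT.
    by apply: pos; exact: subset_itv_oo_cc xab.
  + by apply: cvg_at_right_filter; exact: continuous_powR_gt0.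
  + by apply: cvg_at_left_filter; apply: continuous_powR_gt0; exact: lt_trans ab.
- move=> x xab; rewrite powR_derive1// in_itv/= andbT.
  by apply: pos; exact: subset_itv_oo_cc xab.
- exact/continuous_subspaceT/continuous_expRN.
- split.
  + by move=> x _; apply: ex_derive.
  + by apply: cvg_at_right_filter; apply: cvgN; exact: continuous_expRN.
  + by apply: cvg_at_left_filter; apply: cvgN; exact: continuous_expRN.
- by move=> x _; rewrite derive1E; have [_ ->] := is_derive_expRN x.
Qed.

(** A compact exhaustion of the half-line; the right end n+2 keeps the interval nondegenerate
    already at n = 0. *)
Let I n : set R := `[n.+1%:R^-1, n.+2%:R].

Let bigcup_I : \bigcup_n I n = `]0, +oo[.
Proof.
apply/seteqP; split => [x [n _]|x]; rewrite /I/= !in_itv/= ?andbT.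
  by move=> /andP[+ _]; apply: lt_le_trans; rewrite invr_gt0.
move=> x0.
(* The first entry ensures x < n+2, the second 1/x < n+1. *)
exists (maxn (Num.truncn x) (Num.truncn x^-1)) => //=.
rewrite in_itv/=; apply/andP; split.
  rewrite invf_ple ?posrE//; apply/ltW.
  apply: lt_le_trans (truncnS_gt _) _.
  by rewrite ler_nat ltnS leq_maxr.
apply/ltW/(lt_le_trans (truncnS_gt _)).
by rewrite ler_nat ltnS leqW // leq_maxl.
Qed.

(** Monotone convergence for a nonnegative integrand, valid also when the limit is infinite. *)
Let cvg_integral_I z :
  (\int[mu]_(t in I n) (h z t)%:E @[n --> \oo] -->
   \int[mu]_(t in `]0%R, +oo[) (h z t)%:E)%E.
Proof.
rewrite -bigcup_I; apply: ge0_nondecreasing_set_cvg_integral => //.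
- move=> m n mn; apply/subsetPset/subset_itv; rewrite bnd_simp.
    by rewrite lef_pV2 ?posrE// ler_nat.
  by rewrite ler_nat.
- by move=> n; exact: measurable_itv.
- by move=> n; apply/measurable_EFinP; apply: measurable_h; exact: measurable_itv.
- by move=> n x _; rewrite lee_fin h_ge0.
Qed.

Let cvg_h_inv z : 0 < z -> h z n.+1%:R^-1 @[n --> \oo] --> (0 : R).
Proof.
move=> z0.
apply: (@squeeze_cvgr _ _ _ _ (fun=> 0) (fun n => n.+1%:R^-1 `^ z)).
- by apply: nearW => n; rewrite h_ge0/= /h ler_piMr ?powR_ge0//.
- exact: cvg_cst.
- have /cvg_at_rightP := powR_cvg0 z0; apply; split => [n|].
    by rewrite invr_gt0.
  exact: cvg_harmonic.
Qed.

(** The exponential beats powers: for an integer m >= z and b = n+2, h z b <= (m+1)!/b <=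
    (m+1)!/(n+1). *)
Let cvg_h_nat z : h z n.+2%:R @[n --> \oo] --> (0 : R).
Proof.
have [m zm] : exists m : nat, z <= m%:R.
  by exists (Num.truncn z).+1; exact/ltW/truncnS_gt.
apply: (@squeeze_cvgr _ _ _ _ (fun=> 0) (fun n => m.+1`!%:R * n.+1%:R^-1)).
- apply: nearW => n; rewrite h_ge0/= /h expRN.
  set b : R := n.+2%:R.
  have b0 : 0 < b by rewrite ltr0n.
  have bz : b `^ z <= b ^+ m.
    by rewrite -powR_mulrn ?(ltW b0)// ler_powR// ler1n.
  (* One term of the exponential series: b^(m+1)/(m+1)! <= exp(b). *)
  have bE : b ^+ m * b <= m.+1`!%:R * expR b.
    rewrite -exprSr -ler_pdivrMl ?ltr0n ?fact_gt0// mulrC.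
    by apply: le_trans (expR_ge1Dxn m (ltW b0)); rewrite lerDr.
  apply: (@le_trans _ _ (m.+1`!%:R * b^-1)).
    rewrite ler_pdivrMr ?expR_gt0// mulrAC ler_pdivlMr//.
    by apply: le_trans bE; rewrite ler_pM2r.
  by rewrite ler_wpM2l// lef_pV2 ?posrE// ler_nat.
- exact: cvg_cst.
- rewrite -[0](mulr0 m.+1`!%:R); apply: cvgM; first exact: cvg_cst.
  exact: cvg_harmonic.
Qed.

(** Limit of [integral_h_parts] along [I n]: both boundary terms vanish. The equality is between
    extended reals. *)
Let integral_h_rec z : 0 < z ->
  (\int[mu]_(t in `]0%R, +oo[) (h z t)%:E =
   z%:E * \int[mu]_(t in `]0%R, +oo[) (h (z - 1) t)%:E)%E.
Proof.
move=> z0; apply: (cvg_unique _ (cvg_integral_I z)) => //.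
have IE n : (\int[mu]_(t in I n) (h z t)%:E =
    (h z n.+1%:R^-1 - h z n.+2%:R)%:E +
    z%:E * \int[mu]_(t in I n) (h (z - 1) t)%:E)%E.
  apply: integral_h_parts => //.
  by apply: (@le_lt_trans _ _ 1); rewrite ?invf_le1// ?ler1n ?ltr1n.
rewrite /=; under eq_cvg do rewrite IE.
set E := (z%:E * _)%E; rewrite -(add0e E).
apply: cvgeD => //; last by apply: cvgeZl => //; exact: cvg_integral_I.
apply: cvg_EFin; first exact: nearW.
have := cvgB (cvg_h_inv _ z0) (cvg_h_nat z).
by rewrite subrr; exact.
Qed.

(* If the integral diverges, both sides are 0. *)
Lemma GammaS z : 0 < z -> Gamma (z + 1) = z * Gamma z.
Proof.
move=> z0; rewrite /Gamma addrK.
exact: etrans (congr1 fine (integral_h_rec z z0)) (fine_mul_gt0 z _ z0).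
Qed.

Lemma Gamma1 : Gamma (1 : R) = 1.
Proof.
rewrite /Gamma /Rintegral.
under eq_integral do rewrite subrr powRr0 mul1r.
(* Adding the null endpoint 0 gives the closed half-line on which the fundamental theorem is
   applied. *)
rewrite integral_itv_obnd_cbnd; last first.
  apply/measurable_EFinP/measurable_funTS.
  by apply: continuous_measurable_fun; exact: continuous_expRN.
rewrite (@ge0_continuous_FTC2y R (fun t => expR (- t))
  (fun t => - expR (- t)) _ 0)//=.
- by rewrite oppr0 expR0 sub0r opprK.
- by apply: continuous_subspaceT => x; exact: continuous_expRN.
- by rewrite -oppr0; apply: cvgN; exact: cvgr_expR.
- apply: cvg_at_right_filter; apply: cvgN; exact: continuous_expRN.
- by move=> x _; rewrite derive1E; have [_ ->] := is_derive_expRN x.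
Qed.

Lemma Gamma_rising z k : 0 < z -> Gamma (k%:R + z) = rising z k * Gamma z.
Proof.
move=> z0; elim: k => [|k IHk]; first by rewrite rising0 add0r mul1r.
rewrite -natr1 addrAC GammaS; last by rewrite ltr_wpDl.
by rewrite IHk risingS; ring.
Qed.

Lemma Gamma_fact k : Gamma (k%:R + 1 : R) = k`!%:R.
Proof.
elim: k => [|k IHk]; first by rewrite add0r Gamma1 fact0.
by rewrite -natr1 GammaS ?ltr_wpDl// IHk factS natrM natr1.
Qed.

End gamma_function.

(** * Bounds on the map, on one step and on the orbit *)

Lemma logistic_le {R : realType} (mu x : R) : 0 <= mu -> logistic mu x <= mu / 4.
Proof.
move=> mu0; rewrite /logistic.
(* Completing the square: mu/4 - mu x (1-x) = mu (x - 1/2)^2. *)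
have := mulr_ge0 mu0 (sqr_ge0 (x - 2^-1)); rewrite expr2; lra.
Qed.

(** Here [mu] is any nonnegative upper bound of [f]; the logistic map takes it to be a quarter of
    its parameter. *)
Lemma frac_step_le {R : realType} (q x0 mu : R) (f : R -> R) (x : nat -> R) n :
  0 < q -> q <= 1 -> 0 <= mu -> (forall y, f y <= mu) ->
  frac_step q x0 f x n <= x0 + n.+2%:R `^ q * mu / q.
Proof.
move=> q0 q1 mu0 fmu; rewrite /frac_step lerD2l big_add1 big_mkord.
(* Reversing the sum makes k = n+1-j the index, so that the k-th weight is Gamma(k+q)/Gamma(k+1). *)
rewrite (reindex_inj rev_ord_inj)/= mulr_sumr.
apply: (@le_trans _ _ (\sum_(k < n.+1) (rising q k / k`!%:R) * mu)).
  apply: ler_sum => k _.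
  have -> : n.+1%:R - (n.+1 - k.+1).+1%:R = k%:R :> R.
    have kn : (k <= n)%N by rewrite -ltnS.
    by rewrite subSS -subSn// -natrB ?leq_subr// subKn// ltnW.
  rewrite Gamma_rising// Gamma_fact.
  set c := rising q k / k`!%:R.
  have c0 : 0 <= c by rewrite divr_ge0// rising_ge0// ltW.
  set y := f _.
  have -> : (Gamma q)^-1 * (rising q k * Gamma q / k`!%:R * y) =
      ((Gamma q)^-1 * Gamma q) * (c * y) by rewrite /c; ring.
  (* If [Gamma q] were 0, the term would be 0, still below the nonnegative [c * mu]. *)
  have [->|G0] := eqVneq (Gamma q) 0; first by rewrite mulr0 mul0r mulr_ge0.
  by rewrite mulVf// mul1r ler_wpM2l// fmu.
rewrite -mulr_suml mulrAC ler_wpM2r//.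
exact: sum_rising_fact_le.
Qed.

Theorem theorem1 (R : realType) (q mu x0 gamma : R) (Delta : nat)
    (x : nat -> R)
    (hq0 : 0 < q) (hq1 : q <= 1) (hmu : 0 < mu)
    (hDelta : (1 <= Delta)%N) (hgamma : 0 < gamma + 1)
    (hx0 : x 0%N = x0)
    (hxS : forall n : nat,
       x n.+1 =
         if (n %% Delta)%N != 0%N then frac_step q x0 (logistic mu) x n
         else (1 + gamma) * frac_step q x0 (logistic mu) x n) :
  forall n : nat,
    x n <= Num.max
      (x0 + (n.+1%:R `^ q + 1) * mu / (4 * q))
      ((1 + gamma) * (x0 + (n.+1%:R `^ q + 1) * mu / (4 * q))).
Proof.
case=> [|n].
  rewrite le_max hx0 lerDl divr_ge0 ?mulr_ge0 ?addr_ge0 ?powR_ge0//; exact: ltW.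
have step : frac_step q x0 (logistic mu) x n <=
    x0 + (n.+2%:R `^ q + 1) * mu / (4 * q).
  apply: le_trans (@frac_step_le _ q x0 (mu / 4) _ x n hq0 hq1 _ _) _.
  - by rewrite divr_ge0 ?ltW.
  - by move=> y; exact/logistic_le/ltW.
  have -> : n.+2%:R `^ q * (mu / 4) / q = n.+2%:R `^ q * mu / (4 * q).
    by field; rewrite gt_eqF.
  (* Adding 1 to the power only enlarges the bound. *)
  by rewrite lerD2l ler_pM2r ?invr_gt0 ?mulr_gt0// ler_pM2r// lerDl.
(* Between impulses the first entry of the maximum bounds the value; at an impulse the positive
   factor 1 + gamma preserves [step] and gives the second. *)
rewrite hxS le_max; case: ifP => _; first by rewrite step.
by rewrite ler_pM2l 1?addrC// step orbT.
Qed.
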